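(* The following hold. 1. Suppose $A \subset \mathbb{R}$ has the Baire property. Then $A$ is super-dense if and only if $A$ is co-meager. 2. There exists a set $A \subset \mathbb{R}$ such that both $A$ and $A^c = \mathbb{R}\setminus A$ are dense, but neither $A$ nor $A^c$ is super-dense. 3. There exists a set $A \subset \mathbb{R}$ such that both $A$ and $A^c = \mathbb{R}\setminus A$ are super-dense.
   Context: Nowhere constant: let $I \subset \mathbb{R}$ be a non-empty open interval and $\varphi: I \to \mathbb{R}$ a function. $\varphi$ is non-constant at $t_0 \in I$ if for every $\varepsilon>0$ there is $t \in I \cap (t_0-\varepsilon,t_0+\varepsilon)$ with $\varphi(t) \ne \varphi(t_0)$; $\varphi$ is nowhere constant on $I$ if it is non-constant at every $t \in I$. Super-dense: a set $A \subset \mathbb{R}$ is super-dense if for every non-empty open interval $I$ and every nowhere constant continuous function $\varphi : I \to \mathbb{R}$ one has $\varphi(I \cap A) \cap A \neq \emptyset$. Baire category: $A \subset \mathbb{R}$ is meager if it is an at most countable union of nowhere dense sets, non-meager otherwise, and co-meager if $\mathbb{R}\setminus A$ is meager. $A$ has the Baire property if there are an open set $U$ and a meager set $N$ with $A = U \Delta N$ (symmetric difference). *)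

(* Defs.v *)
From HB Require Import structures.
From mathcomp Require Import all_boot all_order all_algebra.
From mathcomp Require Import all_classical all_reals all_analysis.

Set Implicit Arguments.
Unset Strict Implicit.
Unset Printing Implicit Defensive.

Import Order.TTheory GRing.Theory Num.Theory.
Import numFieldNormedType.Exports.

Local Open Scope classical_set_scope.
Local Open Scope ring_scope.

Section BaireCategory.
Variable T : topologicalType.
Implicit Types A B U N : set T.

Definition nowhere_dense A : Prop := interior (closure A) = set0.

Definition meager A : Prop :=
  exists F : set (set T),
    [/\ countable F, (forall B, F B -> nowhere_dense B) & A = \bigcup_(B in F) B].

Definition comeager A : Prop := meager (~` A).

Definition has_Baire_property A : Prop :=
  exists U N : set T, [/\ open U, meager N & A = U `+` N].

End BaireCategory.

Section SuperDense.
Variable R : realType.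

(* [is_interval] is order-convexity, so unbounded intervals are included. *)
Definition nonempty_open_interval (I : set R) : Prop :=
  [/\ I !=set0, open I & is_interval I].

(* A function on an interval [I] is represented by a total function
   [phi : R -> R]; only its values on [I] are ever constrained or used. *)
Definition nonconstant_at (I : set R) (phi : R -> R) (t0 : R) : Prop :=
  forall e : R, 0 < e ->
    exists2 t, (I `&` `]t0 - e, t0 + e[) t & phi t <> phi t0.

Definition nowhere_constant (I : set R) (phi : R -> R) : Prop :=
  forall t, I t -> nonconstant_at I phi t.

Definition super_dense (A : set R) : Prop :=
  forall (I : set R) (phi : R -> R),
    nonempty_open_interval I -> {within I, continuous phi} ->
    nowhere_constant I phi -> (phi @` (I `&` A)) `&` A !=set0.

End SuperDense.

(* Main.v *)
Require Import Defs.
From mathcomp Require Import all_boot all_order all_algebra.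
From mathcomp Require Import all_classical all_reals all_analysis.
From mathcomp Require Import borel_hierarchy lra.
From mathcomp Require wochoice.

(** Part 1.  If [A] is co-meager and [phi] is continuous and nowhere constant on
[I], then [phi] takes an interval of values near each point
([nowhere_constant_values]), so preimages of meager sets are meager
([nowhere_dense_preimage]); by Baire's theorem some [x] in [I] has both [x] and
[phi x] in [A].  Conversely, let [A] be the symmetric difference of an open set
[U] and a meager set [N].  If [U] is dense, then the complement of [A] is
meager.  Otherwise [A] is contained in [N] on some interval, and it suffices to
find a nowhere constant continuous map of this interval into itself that sends
no point of [N] into [N] ([meager_displaced]).  The generic continuous map is
one: given nowhere dense [C] and [D], every Lipschitz map can be perturbed so
that it takes finitely many values on [C], by precomposing it with a staircase
that climbs only in the gaps of [C], and these values can then be translated off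
[D].  The limit over countably many such conditions is [fusion].

Part 2.  The union of the positive rationals and the nonpositive irrationals is
exchanged with its complement by [x |-> - x] on the positive half line.

Part 3.  A continuous function on an open interval is determined by countably
many bits, so there are at most continuum many tasks of placing some [x] and
[phi x] in [A], or of placing them outside [A].  They are treated one after the
other along a well-order whose proper initial segments are smaller than the
continuum ([short_well_order]).  At each stage fewer than continuum many points
are already placed, whereas [phi] has continuum many values; [fresh_point]
yields a point which, together with its image, avoids everything placed
before. *)

Set Implicit Arguments.
Unset Strict Implicit.
Unset Printing Implicit Defensive.

Import Order.TTheory GRing.Theory Num.Theory.
Import numFieldNormedType.Exports.

Local Open Scope classical_set_scope.
Local Open Scope ring_scope.

(** * Intervals, gaps and meager sets *)

Lemma nested_intervals (R : realType) (l u : nat -> R) :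
  {homo l : m n / (m <= n)%N >-> m <= n} ->
  {homo u : m n / (m <= n)%N >-> n <= m} ->
  (forall n, l n <= u n) -> exists x, forall n, l n <= x <= u n.
Proof.
move=> lnd uni lu.
have lub m n : l m <= u n.
  have [mn|nm] := leqP m n.
    exact: le_trans (lnd _ _ mn) (lu n).
  exact: le_trans (lu m) (uni _ _ (ltnW nm)).
exists (sup (range l)) => n; apply/andP; split.
  apply: ub_le_sup; last by exists n.
  by exists (u 0%N) => _ [m _ <-].
by apply: ge_sup; [exists (l 0%N), 0%N | move=> _ [m _ <-]].
Qed.

Lemma open_ballP (R : realType) (U : set R) (x : R) : open U -> U x ->
  exists2 e, 0 < e & forall y, `|x - y| < e -> U y.
Proof.
move=> oU Ux; have /nbhs_ballP[e /= e0 sub] := open_nbhs_nbhs (conj oU Ux).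
by exists e => // y xy; exact: sub.
Qed.

Lemma open_rat_itv (R : realType) (U : set R) (x : R) : open U -> U x ->
  exists p q : rat, [/\ ratr p < x, x < ratr q &
    forall y, ratr p <= y <= ratr q -> U y].
Proof.
move=> oU /(open_ballP oU)[e e0 eU].
have [p] := @rat_in_itvoo R (x - e) x ltac:(lra).
have [q] := @rat_in_itvoo R x (x + e) ltac:(lra).
rewrite !in_itv /= => /andP[q1 q2] /andP[p1 p2]; exists p, q; split => // y yp.
by apply: eU; rewrite ltr_norml; lra.
Qed.

(** The form in which nowhere density is used throughout: the gap is a closed
interval missing the closure of [C], so it survives small perturbations. *)
Lemma nowhere_dense_gap (R : realType) (C : set R) (a b : R) :
  nowhere_dense C -> a < b ->
  exists p q, [/\ a < p, p < q, q < b & forall x, p <= x <= q -> ~ closure C x].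
Proof.
move=> C0 ab; apply: contrapT => nogap.
suff : interior (closure C) ((a + b) / 2) by rewrite C0.
apply/nbhs_ballP; exists ((b - a) / 2) => /=; first lra.
move=> y /=; rewrite /ball /= ltr_norml => yab.
apply: contrapT => Cy; apply: nogap.
have oO : open (~` closure C `&` `]a, b[).
  by apply: openI; [exact/closed_openC/closed_closure | exact: interval_open].
have [|e e0 eO] := open_ballP oO (x := y).
  by split => //=; rewrite in_itv /=; lra.
have h z : y - e / 2 <= z <= y + e / 2 -> (~` closure C `&` `]a, b[) z.
  by move=> yz; apply: eO; rewrite ltr_norml; lra.
have [_ ] := h (y - e / 2) ltac:(lra); rewrite /= in_itv /= => /andP[ha _].
have [_ ] := h (y + e / 2) ltac:(lra); rewrite /= in_itv /= => /andP[_ hb].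
exists (y - e / 2), (y + e / 2); split => //; first lra.
by move=> x /h[].
Qed.

Section Meager.
Variable T : topologicalType.

Lemma nowhere_denseS (A B : set T) :
  A `<=` B -> nowhere_dense B -> nowhere_dense A.
Proof.
move=> AB B0; apply/seteqP; split => // x Ax.
by rewrite -[set0]B0; apply: interiorS Ax; exact: closureS.
Qed.

Lemma nowhere_dense0 : nowhere_dense (@set0 T).
Proof. by rewrite /nowhere_dense closure0 interior0. Qed.

(** Trades the countable family of the definition for a sequence, and equality
for inclusion; the latter is harmless since nowhere density is hereditary. *)
Lemma meagerP (A : set T) : meager A <->
  exists2 C : nat -> set T,
    (forall n, nowhere_dense (C n)) & A `<=` \bigcup_n C n.
Proof.
split=> [[F [/countable_injP[f finj] F0 ->]]|[C C0 AC]].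
  (* By injectivity of [f] this union is the member of [F] numbered [n], or is
     empty when there is no such member. *)
  exists (fun n => \bigcup_(B in [set B | F B /\ f B = n]) B)
    => [n|x [B FB Bx]].
    have [[B [FB fB]]|noB] := pselect (exists B, F B /\ f B = n).
      apply: nowhere_denseS (F0 _ FB) => x [B' [FB' fB'] B'x].
      by rewrite (finj B B') ?inE // fB fB'.
    apply: nowhere_denseS nowhere_dense0 => x [B FB _].
    by apply: noB; exists B.
  by exists (f B) => //; exists B.
exists (range (fun n => C n `&` A)); split.
- by apply: card_le_trans (card_image_le _ _) _.
- by move=> _ [n _ <-]; apply: nowhere_denseS (C0 n) => x [].
- apply/seteqP; split => [x Ax|x [_ [n _ <-]] [] //].
  by have [n _ Cx] := AC x Ax; exists (C n `&` A) => //; exists n.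
Qed.

Lemma meagerS (A B : set T) : A `<=` B -> meager B -> meager A.
Proof.
move=> AB /meagerP[C C0 BC]; apply/meagerP; exists C => //.
exact: subset_trans BC.
Qed.

Lemma nowhere_dense_meager (A : set T) : nowhere_dense A -> meager A.
Proof.
by move=> A0; apply/meagerP; exists (fun=> A) => // x Ax; exists 0%N.
Qed.

Lemma meagerU (A B : set T) : meager A -> meager B -> meager (A `|` B).
Proof.
move=> /meagerP[C C0 AC] /meagerP[D D0 BD]; apply/meagerP.
exists (fun n => if odd n then D n./2 else C n./2) => [n|x]; first by case: ifP.
case=> [/AC[n _ Cx]|/BD[n _ Dx]].
  by exists n.*2 => //; rewrite odd_double doubleK.
by exists n.*2.+1 => //=; rewrite odd_double /= uphalf_double.
Qed.

End Meager.

(** * Co-meager sets are super-dense *)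

Section SuperDenseOfComeager.
Variable R : realType.
Implicit Types (A I U : set R) (phi : R -> R).

Lemma meager_avoid A U : meager A -> open U -> U !=set0 -> U `\` A !=set0.
Proof.
move=> /meagerP[C C0 AC] oU U0.
have h n : open (~` closure (C n)) /\ @dense R^o (~` closure (C n)).
  split; first exact/closed_openC/closed_closure.
  move=> V [v Vv] oV; apply: contrapT => /forallNP VC.
  suff : interior (closure (C n)) v by rewrite C0.
  apply: filterS (open_nbhs_nbhs (conj oV Vv)) => x Vx.
  by apply: contrapT => Cx; apply: (VC x); split.
have [x [Ux xC]] := @Baire R R^o _ h U U0 oU.
exists x; split => // /AC[n _ Cx]; apply: (xC n) => //.
exact: subset_closure.
Qed.

(** By the intermediate value theorem, [phi] takes a whole nondegenerate
interval of values near every point.  This is the only way in which nowhere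
constancy is exploited, both for preimages of meager sets and for the choice of
fresh points in the transfinite construction. *)
Lemma nowhere_constant_values I phi U (x : R) :
  nonempty_open_interval I -> {within I, continuous phi} ->
  nowhere_constant I phi -> open U -> U x -> I x ->
  exists c d, c < d /\
    forall v, c <= v <= d -> exists z, [/\ I z, U z & phi z = v].
Proof.
move=> [_ oI _]; rewrite continuous_open_subspace // => cphi ncphi oU Ux Ix.
have [|e e0 eIU] := open_ballP (openI oI oU) (x := x); first by [].
have [t [It /=]] := ncphi x Ix e e0.
rewrite in_itv /= => /andP[t1 t2] tx.
have IUz z : Num.min x t <= z <= Num.max x t -> (I `&` U) z.
  move=> xtz; apply: eIU; move: xtz; rewrite ltr_norml.
  by case: (leP x t) => xt /andP[z1 z2]; lra.
exists (Num.min (phi x) (phi t)), (Num.max (phi x) (phi t)); split.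
  by case: (ltgtP (phi x) (phi t)) tx => // ->.
move=> v hv.
have [|||z] := @IVT R phi (Num.min x t) (Num.max x t) v.
- by case: (leP x t) => [|/ltW].
- apply: continuous_in_subspaceT => z; rewrite inE /= in_itv /= => /IUz[Iz _].
  by apply: cphi; rewrite inE.
- by case: (leP x t); rewrite // minC maxC.
by rewrite in_itv /= => /IUz[Iz Uz] <-; exists z.
Qed.

(** If the preimage [D] were dense in an open set, then by continuity all
values of [phi] there would lie in the closure of [C]; but these values fill an
interval, which the nowhere dense set [C] leaves through a gap. *)
Lemma nowhere_dense_preimage I phi C :
  nonempty_open_interval I -> {within I, continuous phi} ->
  nowhere_constant I phi -> nowhere_dense C ->
  nowhere_dense (I `&` phi @^-1` C).
Proof.
move=> Iitv cphi ncphi C0; apply/seteqP; split => // y yD.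
have [_ oI _] := Iitv.
pose D := I `&` phi @^-1` C.
have [x [[Ix _] xD]] : (D `&` interior (closure D)) !=set0.
  apply: (interior_subset yD); apply: open_nbhs_nbhs.
  by split => //; exact: open_interior.
have [c [d [cd cdP]]] :=
  nowhere_constant_values Iitv cphi ncphi (open_interior (closure D)) xD Ix.
have [p [q [cp pq qd pqC]]] := nowhere_dense_gap C0 cd.
have [z [Iz /interior_subset zD phiz]] := cdP p ltac:(lra).
apply: (pqC p); first lra.
rewrite -phiz => V nV; move: cphi.
rewrite continuous_open_subspace // => /(_ z); rewrite inE => /(_ Iz V nV) nz.
have [t [[_ Ct] Vt]] := zD _ nz.
by exists (phi t).
Qed.

(** A point of [I] lying neither in the complement of [A] nor in its preimage
under [phi] is what is needed, and both of these sets are meager. *)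
Lemma comeager_super_dense A : comeager A -> super_dense A.
Proof.
move=> Am I phi Iitv cphi ncphi; have [I0 oI _] := Iitv.
have preim : meager (I `&` phi @^-1` (~` A)).
  have /meagerP[C C0 AC] := Am; apply/meagerP.
  exists (fun n => I `&` phi @^-1` C n) => [n|x [Ix /AC[n _ Cx]]].
    exact: nowhere_dense_preimage.
  by exists n.
have [x [Ix nx]] := meager_avoid (meagerU Am preim) oI I0.
have Ax : A x by apply: contrapT => ?; apply: nx; left.
exists (phi x); split; first by exists x.
by apply: contrapT => ?; apply: nx; right.
Qed.

End SuperDenseOfComeager.

(** * Staircases and fusion of Lipschitz functions *)

Section Fusion.
Variable R : realType.
Implicit Types (f g phi u : R -> R) (a b e : R).

(** The approximants are kept Lipschitz on the whole line so that precomposing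
them with a function close to the identity moves them little. *)
Definition lipschitzian f :=
  exists2 L, 0 <= L & forall x y, `|f x - f y| <= L * `|x - y|.

Lemma lipschitzianD f g :
  lipschitzian f -> lipschitzian g -> lipschitzian (fun x => f x + g x).
Proof.
move=> [L L0 fL] [M M0 gM]; exists (L + M) => [|x y]; first exact: addr_ge0.
rewrite opprD addrACA mulrDl.
by apply: le_trans (ler_normD _ _) _; apply: lerD.
Qed.

Lemma lipschitzian_comp f g :
  lipschitzian f -> lipschitzian g -> lipschitzian (f \o g).
Proof.
move=> [L L0 fL] [M M0 gM]; exists (L * M) => [|x y]; first exact: mulr_ge0.
by apply: le_trans (fL _ _) _; rewrite -mulrA ler_wpM2l.
Qed.

Lemma lipschitzian_cst c : lipschitzian (fun=> c).
Proof. by exists 0 => // x y; rewrite subrr normr0 mul0r. Qed.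

Lemma lipschitzian_scale c : lipschitzian (fun x => c * x).
Proof. by exists `|c| => // x y; rewrite -mulrBr normrM. Qed.

Definition clip (p q x : R) : R := Num.max p (Num.min q x).

Lemma lipschitzian_clip p q : lipschitzian (clip p q).
Proof.
exists 1 => // x y; rewrite mul1r /clip.
wlog xy : x y / x <= y => [h|].
  have [/h //|/ltW/h] := leP x y.
  by rewrite distrC [leRHS]distrC.
rewrite [leRHS]ler0_norm ?subr_le0 // ler_norml.
by case: (leP q x); case: (leP q y); case: (leP p q); case: (leP p x);
   case: (leP p y) => *; apply/andP; split; lra.
Qed.

Lemma clip_le p q x : p <= q -> x <= p -> clip p q x = p.
Proof. by move=> pq xp; rewrite /clip (min_r (le_trans xp pq)) max_l. Qed.

Lemma clip_ge p q x : p <= q -> q <= x -> clip p q x = q.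
Proof. by move=> pq qx; rewrite /clip min_l // max_r. Qed.

Lemma clip_in p q x : p <= q -> p <= clip p q x <= q.
Proof. by move=> pq; rewrite /clip le_max lexx ge_max pq ge_min lexx. Qed.

(** In each of [N] consecutive cells of length [d] the set [C] has a gap.  The
staircase climbs only inside these gaps, by exactly [d] in each, hence it takes
finitely many values on [C] and stays in the same cell as its argument. *)
Lemma staircase (C : set R) a d (N : nat) : nowhere_dense C -> 0 < d ->
  exists u (s : seq R), [/\ lipschitzian u, forall x, C x -> u x \in s &
    forall x, a <= x <= a + d * N%:R -> `|u x - x| <= d].
Proof.
move=> C0 d0.
(* The induction needs the value to the right of the last cell. *)
suff [u [s [ul Cs us]]] : exists u (s : seq R), [/\ lipschitzian u,
    forall x, C x -> u x \in s &
    (forall x, a <= x <= a + d * N%:R -> `|u x - x| <= d) /\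
    forall x, a + d * N%:R <= x -> u x = a + d * N%:R].
  by exists u, s; split => //; case: us.
elim: N => [|N [u [s [ul Cs [ux uN]]]]].
  exists (fun=> a), [:: a]; rewrite mulr0 addr0; split => //.
  - exact: lipschitzian_cst.
  - by move=> x _; rewrite inE.
  - split => // x xa; have -> : x = a by lra.
    by rewrite subrr normr0 ltW.
set aN := a + d * N%:R in ux uN *.
have -> : a + d * N.+1%:R = aN + d by rewrite /aN -natr1 mulrDr mulr1 addrA.
have [p [q [ap pq qd nC]]] := nowhere_dense_gap C0 (ltac:(lra) : aN < aN + d).
pose k := d / (q - p).
have kE : k * (q - p) = d by rewrite /k divfK //; lra.
have k0 : 0 <= k by rewrite /k divr_ge0; lra.
pose v x := u x + k * (clip p q x - p).
have vle x : x <= p -> v x = u x.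
  by move=> xp; rewrite /v clip_le ?subrr ?mulr0 ?addr0 // ltW.
have vge x : q <= x -> v x = u x + d.
  by move=> qx; rewrite /v clip_ge ?kE // ltW.
exists v, (s ++ [seq y + d | y <- s]); split.
- apply: lipschitzianD ul _.
  have -> : (fun x => k * (clip p q x - p)) =
      (fun x => k * clip p q x + (- (k * p))).
    by apply/funext => x; rewrite mulrBr.
  apply: lipschitzianD (lipschitzian_cst _).
  exact: lipschitzian_comp (lipschitzian_scale k) (lipschitzian_clip p q).
- move=> x Cx; rewrite mem_cat; have [xp|px] := leP x p.
    by rewrite vle // Cs.
  have [qx|xq] := leP q x.
    rewrite vge //; apply/orP; right.
    by apply: (map_f (fun y => y + d)); exact: Cs.
  by exfalso; apply: (nC x); [lra | exact: subset_closure].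
- split=> x xa; last first.
    by rewrite vge ?uN //; lra.
  have [xN|Nx] := leP x aN; first by rewrite vle ?ux; lra.
  have /andP[c1 c2] := clip_in x (ltW pq).
  have vx : 0 <= k * (clip p q x - p) <= d.
    by rewrite mulr_ge0 ?subr_ge0 //= -kE ler_wpM2l // lerD2r.
  by rewrite /v uN ?(ltW Nx) // ler_norml; lra.
Qed.

(** Finitely many points can be pushed off a nowhere dense set by a common
small translation, by shrinking the gap one point at a time.  A whole interval
of translations is produced: its half-length is the room left for later
perturbations. *)
Lemma translate_off (D : set R) (s : seq R) e : nowhere_dense D -> 0 < e ->
  exists p q, [/\ 0 < p, p < q, q < e &
    forall t y, p <= t <= q -> y \in s -> ~ D (y + t)].
Proof.
move=> D0 e0; elim: s => [|y s [p [q [p0 pq qe pqs]]]].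
  by exists (e / 3), (e / 2); split => //; lra.
have [p' [q' [pp' p'q' q'q gap]]] :=
  nowhere_dense_gap D0 (ltac:(lra) : y + p < y + q).
exists (p' - y), (q' - y); split; [lra|lra|lra|] => t z tpq.
rewrite inE => /orP[/eqP-> /subset_closure|zs].
  by apply: gap; lra.
by apply: pqs => //; lra.
Qed.

Section Dense.
Variables a b : R.

(** Containing a dense open set for the uniform distance on [`[a, b]], in the
shape in which the Baire category argument consumes it: every closed ball with
Lipschitz centre contains a smaller one, again with Lipschitz centre, on which
[P] holds. *)
Definition dense_open (P : (R -> R) -> Prop) := forall f e,
  lipschitzian f -> 0 < e ->
  exists f' e', [/\ lipschitzian f', 0 < e' <= e / 2,
    forall x, a <= x <= b -> `|f' x - f x| + e' <= e &
    forall g, (forall x, a <= x <= b -> `|g x - f' x| <= e') -> P g].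

(** The staircase [u] makes [f \o u] finitely valued on [C] while moving [f] on
[`[a, b]] by at most its Lipschitz constant times the step [d]; a small
translation then takes these finitely many values off [D]. *)
Lemma dense_open_avoid (C D : set R) : nowhere_dense C -> nowhere_dense D ->
  dense_open (fun g => forall x, a <= x <= b -> C x -> ~ D (g x)).
Proof.
move=> C0 D0 f e fl e0; have [L L0 fL] := fl.
pose d := e / 4 / (L + 1).
have d0 : 0 < d by rewrite !divr_gt0 //; lra.
have Ld : L * d <= e / 4.
  have -> : e / 4 = (L + 1) * d by rewrite /d [RHS]mulrC divfK //; lra.
  by rewrite ler_wpM2r ?(ltW d0) //; lra.
pose N := Num.truncn ((b - a) / d).
have bN : b <= a + d * N.+1%:R.
  rewrite -lerBlDl mulrC -ler_pdivrMr //.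
  by rewrite ltW // truncnS_gt.
have [u [s [ul Cs us]]] := staircase a N.+1 C0 d0.
have [p [q [p0 pq qe pqs]]] := translate_off [seq f y | y <- s] D0
  (ltac:(lra) : 0 < e / 4).
exists (fun x => f (u x) + (p + q) / 2), ((q - p) / 2); split; last 1 first.
- move=> g gf x xab Cx Dg.
  apply: (pqs (g x - f (u x)) (f (u x))).
  + by have := gf x xab; rewrite ler_norml; lra.
  + by apply: (map_f f); exact: Cs.
  + by rewrite addrC subrK.
- apply: lipschitzianD (lipschitzian_cst _).
  exact: lipschitzian_comp fl ul.
- by apply/andP; split; lra.
- move=> x xab; have /us uxd : a <= x <= a + d * N.+1%:R by lra.
  have : `|f (u x) - f x| <= e / 4.
    apply: le_trans (fL _ _) _; apply: le_trans Ld.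
    exact: ler_wpM2l.
  rewrite ler_norml => fux.
  rewrite -lerBrDr ler_norml; lra.
Qed.

(** Adding a small multiple of the identity breaks the equality of the two
values. *)
Lemma dense_open_separate p q : a <= p <= b -> a <= q <= b -> p != q ->
  dense_open (fun g => g p <> g q).
Proof.
move=> pab qab pq f e fl e0.
have [k kx fk] : exists2 k, forall x, a <= x <= b -> `|k * x| <= e / 4 &
    f p + k * p != f q + k * q.
  have [fpq|fpq] := eqVneq (f p) (f q); last first.
    by exists 0 => [x _|]; rewrite ?mul0r ?addr0 // normr0; lra.
  pose M := `|a| + `|b| + 1.
  have M0 : 0 < M.
    by rewrite /M; have := normr_ge0 a; have := normr_ge0 b; lra.
  exists (e / 4 / M) => [x xab|].
    rewrite normrM ger0_norm ?divr_ge0 ?(ltW M0) //; last lra.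
    rewrite mulrAC ler_pdivrMr // ler_wpM2l //; first lra.
    have := ler_norm b; have := ler_norm (- a); rewrite normrN.
    have := normr_ge0 a; have := normr_ge0 b.
    rewrite ler_norml /M; lra.
  rewrite fpq (inj_eq (addrI _)) (inj_eq (mulfI _)) //.
  by rewrite gt_eqF // divr_gt0 //; lra.
pose f' x := f x + k * x.
pose r := `|f' p - f' q|.
have r0 : 0 < r by rewrite normr_gt0 subr_eq0.
pose e' := Num.min (e / 2) (r / 3).
have e'0 : 0 < e' by rewrite lt_min; apply/andP; split; lra.
have e'e : e' <= e / 2 by rewrite ge_min lexx.
have e'r : e' <= r / 3 by rewrite ge_min lexx orbT.
exists f', e'; split.
- exact: lipschitzianD fl (lipschitzian_scale k).
- by rewrite e'0.
- move=> x /kx; rewrite /f' addrAC subrr add0r; lra.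
- move=> g gf gpq; have := gf p pab; have := gf q qab.
  rewrite gpq => h1 h2; have : r <= e' + e'; last lra.
  rewrite /r -[f' p - f' q](subrKA (g q)).
  apply: le_trans (ler_normD _ _) (lerD _ _) => //.
  by rewrite distrC.
Qed.

Lemma dense_open_imp (H : Prop) (P : (R -> R) -> Prop) :
  (H -> dense_open P) -> dense_open (fun g => H -> P g).
Proof.
move=> HP f e fl e0; have [h|nh] := pselect H.
  have [f' [e' [fl' e'0 fe' gP]]] := HP h f e fl e0.
  by exists f', e'; split => // g /gP.
exists f, (e / 2); split => //; first lra.
by move=> x _; rewrite subrr normr0; lra.
Qed.

(** Baire category argument for continuous functions on [`[a, b]].  The nested
balls have, at each point, nested intervals of values with lengths tending to
zero; [phi] is their common value, so it lies in all the balls and is a uniform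
limit of Lipschitz functions. *)
Lemma fusion (I : countType) (P : I -> (R -> R) -> Prop) f0 e0 :
  (forall i, dense_open (P i)) -> lipschitzian f0 -> 0 < e0 ->
  exists phi, [/\ forall x, a <= x <= b -> `|phi x - f0 x| <= e0,
    forall x, a < x < b -> {for x, continuous phi} & forall i, P i phi].
Proof.
move=> Pdo f0l e00.
pose Q n := if unpickle n is Some i then P i else fun=> True.
have Qdo n : dense_open (Q n).
  rewrite /Q; case: unpickle => [i|] // f e fl e_gt0.
  exists f, (e / 2); split => //; first lra.
  by move=> x _; rewrite subrr normr0; lra.
pose good n (s s' : (R -> R) * R) := lipschitzian s.1 -> 0 < s.2 ->
  [/\ lipschitzian s'.1, 0 < s'.2 <= s.2 / 2,
    forall x, a <= x <= b -> `|s'.1 x - s.1 x| + s'.2 <= s.2 &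
    forall g, (forall x, a <= x <= b -> `|g x - s'.1 x| <= s'.2) -> Q n g].
have /choice[next nextP] : forall t : nat * ((R -> R) * R),
    exists s', good t.1 t.2 s'.
  move=> [n [f e]]; rewrite /good /=.
  have [[fl e_gt0]|] := pselect (lipschitzian f /\ 0 < e).
    by have [f' [e' h]] := Qdo n f e fl e_gt0; exists (f', e').
  by move=> h; exists (f, e) => fl e_gt0; exfalso; exact: h.
pose st := fix st n := if n is m.+1 then next (m, st m) else (f0, e0).
pose f n := (st n).1; pose e n := (st n).2.
have [fl e_gt0] : (forall n, lipschitzian (f n)) /\ (forall n, 0 < e n).
  suff h n : lipschitzian (f n) /\ 0 < e n by split=> n; case: (h n).
  elim: n => // n [fl en]; have [] := nextP (n, st n) fl en.
  by move=> ? /andP[].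
have step n : [/\ e n.+1 <= e n / 2,
    forall x, a <= x <= b -> `|f n.+1 x - f n x| + e n.+1 <= e n &
    forall g, (forall x, a <= x <= b -> `|g x - f n.+1 x| <= e n.+1) -> Q n g].
  by have [_ /andP[_ ?] ? ?] := nextP (n, st n) (fl n) (e_gt0 n); split.
have /choice[phi phiP] : forall x, exists y, a <= x <= b ->
    forall n, `|y - f n x| <= e n.
  move=> x.
  have [xab|] := pselect (a <= x <= b); last by exists 0.
  have h n : `|f n.+1 x - f n x| <= e n - e n.+1.
    by rewrite lerBrDr; case: (step n) => _ ->.
  have [||n|y yP] := @nested_intervals R
      (fun n => f n x - e n) (fun n => f n x + e n).
  - by apply/nondecreasing_seqP => n; have := h n; rewrite ler_norml; lra.
  - by apply/nonincreasing_seqP => n; have := h n; rewrite ler_norml; lra.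
  - by have := e_gt0 n; lra.
  - by exists y => _ n; have := yP n; rewrite ler_norml; lra.
exists phi; split.
- by move=> x xab; exact: (phiP x xab 0%N).
- move=> x xab.
  have e_small n : e n * 2 ^+ n <= e0.
    elim: n => [|n IH]; first by rewrite mulr1.
    apply: le_trans IH; rewrite exprS mulrA ler_pM2r ?exprn_gt0 //.
    by have [] := step n; lra.
  apply/cvgrPdist_lt => r r0.
  have [n en] : exists n, e n < r / 3.
    pose n := Num.truncn (e0 / (r / 3)); exists n.
    have : e0 / (r / 3) < 2 ^+ n.
      apply: lt_le_trans (truncnS_gt _) _.
      by rewrite -natrX ler_nat -/n ltn_expl.
    rewrite ltr_pdivrMr; last lra.
    move=> /(le_lt_trans (e_small n)).
    by rewrite mulrC ltr_pM2l // exprn_gt0.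
  have [L L0 fL] := fl n.
  pose d := Num.min (Num.min (x - a) (b - x)) (r / 3 / (L + 1)).
  have r3 : 0 < r / 3 / (L + 1) by rewrite !divr_gt0 //; lra.
  apply/nbhs_ballP; exists d => /= [|y].
    by rewrite !lt_min r3 !subr_gt0 andbT.
  rewrite /ball /= /d !lt_min => /andP[/andP[xya xyb] xyr].
  have yab : a <= y <= b by move: xya xyb; rewrite !ltr_norml; lra.
  have : L * `|x - y| <= r / 3.
    have -> : r / 3 = (L + 1) * (r / 3 / (L + 1)).
      by rewrite [RHS]mulrC divfK //; lra.
    by apply: ler_pM => //; [lra | exact: ltW].
  have := fL x y.
  have := phiP y yab n; have := phiP x ltac:(lra) n.
  rewrite !ler_norml !ltr_norml; lra.
- move=> i; have [_ _] := step (pickle i).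
  by rewrite /Q pickleK; apply=> x xab; exact: phiP.
Qed.

End Dense.
End Fusion.

(** * Super-dense sets with the Baire property are co-meager *)

Section ComeagerOfSuperDense.
Variable R : realType.

Lemma itvoo_nonempty_open_interval (a b : R) :
  a < b -> nonempty_open_interval `]a, b[.
Proof.
move=> ab; split; last exact: interval_is_interval.
- by exists ((a + b) / 2); rewrite /= in_itv /=; lra.
- exact: interval_open.
Qed.

(** The generic continuous map displaces a given meager set from itself and is
nowhere constant.  Both requirements are countable conjunctions of dense open
conditions: one for each pair of nowhere dense pieces of [N], and one for each
pair of distinct rationals. *)
Lemma meager_displaced (a b : R) (N : set R) : a < b -> meager N ->
  exists phi : R -> R, [/\ {within `]a, b[, continuous phi},
    nowhere_constant `]a, b[ phi,
    forall x, a < x < b -> a < phi x < b &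
    forall x, a < x < b -> N x -> ~ N (phi x)].
Proof.
move=> ab /meagerP[C C0 NC].
pose P (i : (nat * nat) + (rat * rat)) (g : R -> R) := match i with
  | inl (i, j) => forall x, a <= x <= b -> C i x -> ~ C j (g x)
  | inr (p, q) => [/\ a <= ratr p <= b, a <= ratr q <= b & p != q] ->
      g (ratr p) <> g (ratr q)
  end.
have Pdo i : dense_open a b (P i).
  case: i => [[i j]|[p q]]; first exact: dense_open_avoid.
  apply: dense_open_imp => -[pab qab pq].
  by apply: dense_open_separate; rewrite ?(inj_eq (fmorph_inj _)).
(* Radius and centre keep the values of [phi] inside ]a, b[. *)
have [phi [phi_near phic phiP]] := fusion Pdo
  (lipschitzian_cst ((a + b) / 2)) (ltac:(lra) : 0 < (b - a) / 4).
exists phi; split.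
- apply: continuous_in_subspaceT => x; rewrite inE /= in_itv /=; exact: phic.
- move=> t /=; rewrite in_itv /= => tab e e0.
  have [p] := @rat_in_itvoo R (Num.max a (t - e)) t ltac:(rewrite gt_max; lra).
  have [q] := @rat_in_itvoo R t (Num.min b (t + e)) ltac:(rewrite lt_min; lra).
  rewrite !in_itv /= lt_min gt_max => /and3P[tq qb qe] /andP[/andP[ap ep] pt].
  have pq : p != q by apply/eqP => pq; move: pt; rewrite pq; lra.
  have phipq : phi (ratr p) <> phi (ratr q).
    by apply: (phiP (inr (p, q))); split => //; lra.
  have [phipt|/eqP phipt] := eqVneq (phi (ratr p)) (phi t).
    exists (ratr q); last by rewrite -phipt; exact: nesym.
    by split; rewrite /= in_itv /=; lra.
  by exists (ratr p) => //; split; rewrite /= in_itv /=; lra.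
- move=> x xab; have := phi_near x ltac:(lra); rewrite ler_norml; lra.
- move=> x xab /NC[i _ Cx] /NC[j _]; apply: (phiP (inl (i, j))) Cx; lra.
Qed.

(** If [U] misses an interval, then [A] is meager there and is displaced from
itself by some nowhere constant map of this interval, against super-density.
So the open set [U] is dense, and its complement is nowhere dense. *)
Lemma super_dense_comeager (A : set R) :
  has_Baire_property A -> super_dense A -> comeager A.
Proof.
move=> [U [N [oU Nm AUN]]] Asd.
suff U0 : nowhere_dense (~` U).
  apply: meagerS (meagerU (nowhere_dense_meager U0) Nm) => x nAx.
  have [Ux|nUx] := pselect (U x); last by left.
  by right; apply: contrapT => nNx; apply: nAx; rewrite AUN; left.
apply/seteqP; split => // y.
rewrite -((closure_id (~` U)).1 (open_closedC oU)) => Uy.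
 have [e e0 eU] := open_ballP (@open_interior _ (~` U)) Uy.
have ab : y - e < y + e by lra.
have [phi [phic phinc phiab phiN]] := meager_displaced ab Nm.
have AN x : y - e < x < y + e -> A x -> N x.
  move=> xe; rewrite AUN => -[[Ux _]|[] //]; exfalso.
  by have /interior_subset := eU x ltac:(rewrite ltr_norml; lra).
have [z [[x [xab Ax] <-] Az]] :=
  Asd _ _ (itvoo_nonempty_open_interval ab) phic phinc.
move: xab; rewrite /= in_itv /= => xab.
exact: (phiN x xab (AN x xab Ax)) (AN _ (phiab x xab) Az).
Qed.

End ComeagerOfSuperDense.

(** * A dense and codense set, neither side of which is super-dense *)

Section DenseNotSuperDense.
Variable R : realType.

Lemma dense_signed (A : set R) :
  (forall a b : R, a < b -> 0 <= a \/ b <= 0 -> exists x, a < x < b /\ A x) ->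
  dense A.
Proof.
move=> h O [x Ox] /open_ballP/(_ Ox)[e e0 eO].
have [x0|x0] := leP 0 x.
  have [|y [xy Ay]] := h x (x + e) ltac:(lra); first by left.
  by exists y; split => //; apply: eO; rewrite ltr_norml; lra.
have [|y [xy Ay]] := h (x - e) x ltac:(lra); first by right; lra.
by exists y; split => //; apply: eO; rewrite ltr_norml; lra.
Qed.

Lemma irrational_in_itvoo (a b : R) :
  a < b -> exists x, a < x < b /\ irrational x.
Proof.
move=> ab; have [F Fod FE] := @irrational_Gdelta R.
have [ab0 oab _] := itvoo_nonempty_open_interval ab.
have [x [xab Fx]] := @Baire R R^o F Fod _ ab0 oab.
by exists x; rewrite FE; split => //; move: xab; rewrite /= in_itv.
Qed.

(** With the positive rationals and the nonpositive irrationals in [A], the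
reflection [x |-> - x] exchanges [A] and its complement on the positive half
line. *)
Lemma dense_not_super_dense : exists A : set R,
  [/\ dense A, dense (~` A), ~ super_dense A & ~ super_dense (~` A)].
Proof.
pose A := [set x : R | if 0 < x then rational x else irrational x].
have rat_itv (a b : R) : a < b -> exists x, a < x < b /\ rational x.
  by move=> /rat_in_itvoo[q qab]; exists (ratr q); split => //; exists q.
have itv0 : nonempty_open_interval `]0%R : R, +oo[.
  split; last exact: interval_is_interval.
  - by exists 1; rewrite /= in_itv /= ltr01.
  - exact: interval_open.
have Nc : {within `]0%R : R, +oo[, continuous (-%R : R -> R)}.
  by apply: continuous_subspaceT => x; exact: opp_continuous.
have Nnc : nowhere_constant `]0%R : R, +oo[ (-%R : R -> R).
  move=> t; rewrite /= in_itv /= => t0 e e0; exists (t + e / 2).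
    by split; rewrite /= in_itv /=; lra.
  by move=> /oppr_inj; lra.
have AN (x : R) : 0 < x -> A (- x) <-> ~ A x.
  move=> x0; rewrite /A /= x0 ltNge oppr_le0 ltW //= /irrational /=.
  have -> // : rational (- x) = rational x.
  apply/propext; split => -[q _ qx]; exists (- q) => //;
    rewrite raddfN /= qx //.
  by rewrite opprK.
exists A; split.
- apply: dense_signed => a b ab [a0|b0].
    have [x [xab Qx]] := rat_itv a b ab; exists x; split => //.
    by rewrite /A /= (_ : 0 < x) //; lra.
  have [x [xab Ix]] := irrational_in_itvoo ab; exists x; split => //.
  by rewrite /A /= ltNge (_ : x <= 0) //; lra.
- apply: dense_signed => a b ab [a0|b0].
    have [x [xab Ix]] := irrational_in_itvoo ab; exists x; split => //.
    by rewrite /A /= (_ : 0 < x) //; lra.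
  have [x [xab Qx]] := rat_itv a b ab; exists x; split => //.
  by rewrite /A /= ltNge (_ : x <= 0) /=; [exact | lra].
- move=> /(_ _ _ itv0 Nc Nnc)[_ [[x [x0 Ax] <-]]].
  by move: x0; rewrite /= in_itv /= andbT => x0 /(AN x x0).
- move=> /(_ _ _ itv0 Nc Nnc)[_ [[x [x0 Ax] <-]]].
  by move: x0; rewrite /= in_itv /= andbT => x0; apply; exact/(AN x x0).
Qed.

End DenseNotSuperDense.

(** * Well-orders with small initial segments and transfinite recursion *)

(** A transfinite enumeration of [X], by [c] restricted to [D], all of whose
proper initial segments are too small to be mapped onto [X].  Take any
well-order: if some initial segment maps onto [X], then the least such segment
is the required index set, enumerated by that map; otherwise the whole of [X]
will do. *)
Lemma short_well_order (X : eqType) :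
  exists (lt : X -> X -> Prop) (D : set X) (c : X -> X),
  [/\ well_founded lt,
      forall v w, v <> w -> lt v w \/ lt w v,
      forall x, exists2 w, D w & c w = x &
      forall w (e : X -> X), D w -> exists x, forall v, lt v w -> e v <> x].
Proof.
have [r wo] := wochoice.well_ordering_principle X.
have minP (P : set X) : P !=set0 -> exists2 z, P z & forall x, P x -> r z x.
  move=> [x Px]; have [|z [[]]] := wo [pred x | `[< P x >]].
    by exists x; apply/asboolP.
  move=> /asboolP Pz zmin _; exists z => // y Py; apply: zmin; exact/asboolP.
have anti x y : r x y -> r y x -> x = y.
  move=> xy yx; have [|z [_ zu]] := wo (pred2 x y).
    by exists x; rewrite !inE eqxx.
  have rr t : r t t.
    by have [|u -> ut] := minP [set t]; [exists t | exact: ut].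
  have zx : z = x.
    by apply: zu; split=> [|u]; rewrite !inE ?eqxx // => /orP[]/eqP->.
  rewrite -zx; apply: zu.
  by split=> [|u]; rewrite !inE ?eqxx ?orbT // => /orP[]/eqP->.
pose lt v w := r v w /\ v <> w.
have wf : well_founded lt.
  move=> x; apply: contrapT => nx.
  have [|z nz zmin] := minP [set y | ~ Acc lt y]; first by exists x.
  apply: nz; constructor => y [yz yNz]; apply: contrapT => ny.
  by apply: yNz; apply: anti => //; exact: zmin.
have tot v w : v <> w -> lt v w \/ lt w v.
  move=> vw; have [|z [->|->] zmin] := minP [set v; w]; first by exists v; left.
    by left; split => //; apply: zmin; right.
  by right; split; [apply: zmin; left | exact: nesym].
pose bad w := exists e : X -> X, forall x, exists2 v, lt v w & e v = x.
have notbad w (e : X -> X) : ~ bad w -> exists x, forall v, lt v w -> e v <> x.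
  move=> nb; apply: contrapT => /forallNP h; apply: nb; exists e => x.
  apply: contrapT => h'; apply: (h x) => v vw evx; apply: h'; by exists v.
have [nobad|] := pselect (forall w, ~ bad w).
  exists lt, setT, id; split => // [x|w e _]; first by exists x.
  exact: notbad.
move=> /existsNP[w0 /contrapT bw0].
have [|w [e eP] wmin] := minP bad; first by exists w0.
exists lt, (fun v => lt v w), e; split => // v f vw.
apply: notbad => /wmin wv.
by case: vw => vw; apply; exact: anti.
Qed.

(** Choice along a well-founded relation, where the constraint [P w x y] on the
value at [w] depends on [x] only through the values at smaller indices. *)
Lemma wf_recursive_choice (X Y : Type) (lt : X -> X -> Prop)
    (P : X -> (X -> Y) -> Y -> Prop) (y0 : Y) :
  well_founded lt ->
  (forall w f g y, (forall v, lt v w -> f v = g v) -> P w f y -> P w g y) ->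
  (forall w f, exists y, P w f y) ->
  exists x : X -> Y, forall w, P w x (x w).
Proof.
move=> wf Pext Pex.
have [s sP] := choice (fun t : X * (X -> Y) => Pex t.1 t.2).
pose ext w (rec : forall v, lt v w -> Y) v :=
  if pselect (lt v w) is left h then rec v h else y0.
pose F w rec := s (w, ext w rec).
pose x := Fix wf (fun=> Y) F.
have xE w : x w = F w (fun v _ => x v).
  rewrite /x Fix_eq // => {}w f g fg; congr (s (_, _)).
  by apply/funext => v; rewrite /ext; case: pselect.
exists x => w; rewrite xE; apply: Pext (sP (w, ext w (fun v _ => x v))) => v vw.
by rewrite /= /ext; case: pselect.
Qed.

(** * Fresh points avoiding fewer than continuum many obstacles *)

Section Continuum.
Variable R : realType.

(** The ternary Cantor set scaled to [`[c, d]]: the sequence [s] selects the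
left or the right third of the current interval, and distinct selections lead
to disjoint thirds. *)
Lemma cantor_injection (c d : R) : c < d ->
  exists j : (nat -> bool) -> R, injective j /\ forall s, c <= j s <= d.
Proof.
move=> cd.
pose w n : R := (d - c) / 3 ^+ n.
have w0 n : 0 < w n by rewrite divr_gt0 ?subr_gt0 ?exprn_gt0.
have wS n : w n = 3 * w n.+1.
  by rewrite /w exprS invfM mulrCA mulVKf.
pose l (s : nat -> bool) := fix l n : R :=
  if n is m.+1 then l m + (if s m then 2 * w n else 0) else c.
have lS s n : l s n.+1 = l s n + (if s n then 2 * w n.+1 else 0) by [].
have /choice[j jP] : forall s, exists x, forall n, l s n <= x <= l s n + w n.
  move=> s; apply: (@nested_intervals R (l s) (fun n => l s n + w n)).
  - apply/nondecreasing_seqP => n; rewrite lS.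
    by have := w0 n.+1; case: (s n); lra.
  - apply/nonincreasing_seqP => n; rewrite lS.
    by have := w0 n.+1; have := wS n; case: (s n); lra.
  - by move=> n; have := w0 n; lra.
exists j; split=> [s t jst|s]; last first.
  by have := jP s 0%N; rewrite /w /= expr0 divr1; lra.
have agree n : l s n = l t n -> s n = t n.
  move=> lst; have := jP s n.+1; have := jP t n.+1; rewrite jst !lS lst.
  by have := w0 n.+1; case: (s n); case: (t n) => //; lra.
have lst n : l s n = l t n.
  by elim: n => // n IH; rewrite !lS IH (agree n IH).
by apply/funext => n; exact: agree.
Qed.

(** Diagonal argument in the style of Koenig.  Here [V] does not map onto the
set [X] of all [T -> bool], so for each [k] some element [z k] of [X] differs
from the [k]-th coordinate of every [e k v], the points of an interval being
read as sequences in [X].  The point encoding the sequence [z] then differs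
from every [e k v]. *)
Lemma fresh_point (T : countType) (V : set (T -> bool))
    (e : nat -> (T -> bool) -> R) (c d : R) : c < d ->
  (forall f : (T -> bool) -> (T -> bool),
    exists x, forall v, V v -> f v <> x) ->
  exists2 y, c <= y <= d & forall k v, V v -> e k v <> y.
Proof.
move=> cd Vsmall; have [j [jinj jcd]] := cantor_injection cd.
pose enc (z : nat -> T -> bool) (n : nat) :=
  if unpickle n is Some (k, t) then z k t else false.
have encE z k t : enc z (pickle (k, t)) = z k t by rewrite /enc pickleK.
pose J z := j (enc z).
have Jinj : injective J.
  move=> z z' /jinj E; apply/funext => k; apply/funext => t.
  by rewrite -encE E encE.
have /choice[g gP] : forall y, exists z, (exists z', J z' = y) -> J z = y.
  move=> y; have [[z Jz]|nz] := pselect (exists z', J z' = y).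
    by exists z.
  by exists (fun _ _ => false) => /nz.
have gK z : g (J z) = z by apply: Jinj; apply: gP; exists z.
have /choice[z zP] := fun k => Vsmall (fun v => g (e k v) k).
exists (J z); first exact: jcd.
by move=> k v Vv ekv; apply: (zP k v Vv); rewrite ekv gK.
Qed.

Lemma continuous_lt_rat (f g : R -> R) (I : set R) (x : R) :
  open I -> {in I, continuous f} -> {in I, continuous g} -> I x -> f x < g x ->
  exists q : rat, I (ratr q) /\ f (ratr q) < g (ratr q).
Proof.
move=> oI cf cg Ix fg; pose m := (f x + g x) / 2.
have xI : x \in I by rewrite inE.
have nf : \forall y \near x, f y < m.
  by apply: cvgr_lt (cf x xI) _ _; rewrite /m; lra.
have ng : \forall y \near x, m < g y.
  by apply: cvgr_gt (cg x xI) _ _; rewrite /m; lra.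
have nI : \forall y \near x, I y by apply: open_nbhs_nbhs; split.
have : nbhs x [set y | [/\ I y, f y < m & m < g y]].
  by near=> y; split; near: y.
rewrite nbhsE => -[V [oV Vx] sub].
have [p [q [px xq pqV]]] := open_rat_itv oV Vx.
exists p; have [Ip fm mg] := sub _ (pqV (ratr p) ltac:(lra)).
by split => //; exact: lt_trans mg.
Unshelve. all: by end_near. Qed.

End Continuum.

(** * A set which is super-dense together with its complement *)

Section Bernstein.
Variable R : realType.

(** A task: an interval, a function on it, and the side of the partition on
which a point and its image have to be placed. *)
Let datum : Type := set R * (R -> R) * bool.
Let code : Type := option (rat * rat) -> bool.

Definition admissible (t : datum) := let: (U, phi, _) := t in
  [/\ nonempty_open_interval U, {within U, continuous phi} &
      nowhere_constant U phi].

(** A task is recorded by countably many bits, the interval and the function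
being read off from the rationals below the values at rational points. *)
Definition encode (t : datum) : code := let: (U, phi, b) := t in
  fun o => if o is Some (r, s) then `[< U (ratr r) /\ ratr s < phi (ratr r) >]
           else b.

(** Rational points determine an open interval and a continuous function on it.
The functions can only agree on the interval, which is all that super-density
looks at. *)
Lemma encode_inj I phi b I' phi' b' :
  admissible (I, phi, b) -> admissible (I', phi', b') ->
  encode (I, phi, b) = encode (I', phi', b') ->
  [/\ I = I', b = b' & forall x, I x -> phi x = phi' x].
Proof.
suff key J psi c J' psi' c' :
    admissible (J, psi, c) -> admissible (J', psi', c') ->
    encode (J, psi, c) = encode (J', psi', c') ->
    J `<=` J' /\ forall x, J x -> psi x <= psi' x.
  move=> t t' E; have [II' le] := key _ _ _ _ _ _ t t' E.
  have [I'I ge] := key _ _ _ _ _ _ t' t (esym E).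
  have eqI : I = I' by apply/seteqP; split.
  split => //; first exact: (congr1 (fun f => f None) E).
  by move=> x Ix; apply/eqP; rewrite eq_le le // ge // -eqI.
move=> [[_ oJ iJ] cpsi _] [[_ oJ' iJ'] cpsi' _] E.
have Es r s : J (ratr r) -> ratr s < psi (ratr r) ->
    J' (ratr r) /\ ratr s < psi' (ratr r).
  move=> Jr sr; have /(congr1 (fun f => f (Some (r, s)))) := E.
  rewrite /encode /= => h; apply/asboolP; rewrite -h; exact/asboolP.
have JJ'r r : J (ratr r) -> J' (ratr r).
  move=> Jr.
  have [s] := @rat_in_itvoo R (psi (ratr r) - 1) (psi (ratr r)) ltac:(lra).
  by rewrite in_itv /= => /andP[_ /(Es r s Jr)[]].
have JJ' : J `<=` J'.
  move=> x Jx; have [p [q [px xq pqJ]]] := open_rat_itv oJ Jx.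
  by apply: (iJ' (ratr p) (ratr q)); rewrite ?ltW //;
    apply: JJ'r; apply: pqJ; lra.
split => // x Jx; rewrite leNgt; apply/negP => lt.
move: cpsi cpsi'; rewrite !continuous_open_subspace // => cpsi cpsi'.
have cpsi'J : {in J, continuous psi'}.
  by move=> y; rewrite inE => /JJ' J'y; apply: cpsi'; rewrite inE.
have [q [Jq]] := continuous_lt_rat oJ cpsi'J cpsi Jx lt.
move=> /rat_in_itvoo[s]; rewrite in_itv /= => /andP[s1 s2].
by have [_] := Es q s Jq s2; lra.
Qed.

(** Bernstein-type construction.  At stage [w] a point [x w] of the interval of
the [w]-th task is chosen so that it and its image avoid all earlier chosen
points and their images.  Hence points from stages on different sides never
meet, and each side satisfies all its tasks. *)
Lemma super_dense_partition :
  exists A : set R, super_dense A /\ super_dense (~` A).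
Proof.
have [lt [D [c [wf tot csurj short]]]] := short_well_order code.
have /choice[dec decP] : forall x : code, exists t : datum,
    (exists2 t', admissible t' & encode t' = x) ->
    admissible t /\ encode t = x.
  move=> x; have [[t at' tx]|nt] := pselect
    (exists2 t', admissible t' & encode t' = x); first by exists t.
  by exists (set0, id, false) => /nt.
pose dom w := (dec (c w)).1.1; pose fn w := (dec (c w)).1.2.
pose side w := (dec (c w)).2.
pose P w (x : code -> R) y := D w -> admissible (dec (c w)) ->
  dom w y /\ forall v, lt v w ->
  [/\ x v <> y, fn v (x v) <> y, x v <> fn w y & fn v (x v) <> fn w y].
(* The four inequations say that the pair of stage [v] and the pair of stage
   [w] are disjoint. *)
have [x xP] : exists x : code -> R, forall w, P w x (x w).
  apply: (wf_recursive_choice 0 wf) => [w f g y fg Pf Dw aw|w x].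
    have [dy fresh] := Pf Dw aw; split=> // v vw.
    by have := fresh v vw; rewrite (fg v vw).
  have [[Dw aw]|] := pselect (D w /\ admissible (dec (c w))); last first.
    by move=> h; exists 0 => Dw aw; exfalso; exact: h.
  have := aw; rewrite /P /dom /fn.
  case: (dec (c w)) => -[I phi] b /= [Iitv cphi ncphi].
  have [[z Iz] _ _] := Iitv.
  have [l [u [lu vals]]] :=
    nowhere_constant_values Iitv cphi ncphi openT (Logic.I : setT z) Iz.
  have /choice[sec secP] : forall y, exists z, l <= y <= u -> I z /\ phi z = y.
    move=> y; have [/vals[t [It _ ty]]|] := pselect (l <= y <= u).
      by exists t.
    by move=> ny; exists 0 => /ny.
  (* [sec] is a section of [phi] over an interval of values; a value [y] is
     excluded when [y] or [sec y] is an earlier point or an earlier image. *)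
  pose e k v := nth 0 [:: phi (x v); phi (fn v (x v)); x v; fn v (x v)] k.
  have [|y ylu yfresh] := @fresh_point R _ (fun v => lt v w) e l u lu.
    by move=> f; exact: short.
  have [Iy phiy] := secP y ylu.
  exists (sec y) => _ _; split => // v vw; rewrite phiy; split.
  - by move=> E; apply: (yfresh 0%N v vw); exact: etrans (congr1 phi E) phiy.
  - by move=> E; apply: (yfresh 1%N v vw); exact: etrans (congr1 phi E) phiy.
  - exact: (yfresh 2%N v vw).
  - exact: (yfresh 3%N v vw).
pose A := [set z | exists w, [/\ D w, admissible (dec (c w)), side w &
  z = x w \/ z = fn w (x w)]].
have stage I phi b : admissible (I, phi, b) -> exists w,
    [/\ D w, admissible (dec (c w)), side w = b, I (x w) &
      fn w (x w) = phi (x w)].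
  move=> at'; have [w Dw cw] := csurj (encode (I, phi, b)).
  have [aw ew] := decP (c w) (ex_intro2 _ _ _ at' (esym cw)).
  have [Ixw _] := xP w Dw aw; exists w.
  move: aw ew Ixw; rewrite /side /fn /dom.
  case: (dec (c w)) => -[I' phi'] b' aw; rewrite cw => E /= Ix.
  have [II' bb' eqphi] := encode_inj aw at' E.
  by split => //; [rewrite -II' | exact: eqphi].
exists A; split => I phi Iitv cphi ncphi.
  have [w [Dw aw sw Ix xphi]] := stage I phi true (And3 Iitv cphi ncphi).
  exists (phi (x w)); split.
    by exists (x w) => //; split => //; exists w; split => //; left.
  by exists w; split => //; right.
have [w [Dw aw sw Ix xphi]] := stage I phi false (And3 Iitv cphi ncphi).
have nA z : z = x w \/ z = fn w (x w) -> ~ A z.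
  move=> zw [v [Dv av sv zv]].
  have vw : v <> w by move=> vw; move: sv; rewrite vw sw.
  have [_ freshw] := xP w Dw aw; have [_ freshv] := xP v Dv av.
  case: (tot v w vw) => [/freshw|/freshv] [h1 h2 h3 h4];
    by case: zw => zw; case: zv => zv;
      [apply: h1|apply: h2|apply: h3|apply: h4]; congruence.
exists (phi (x w)); split; last by rewrite -xphi; apply: nA; right.
by exists (x w) => //; split => //; apply: nA; left.
Qed.

End Bernstein.

(** * Super-density and Baire category *)

Theorem theorem1p3 (R : realType) :
  [/\ forall A : set R, has_Baire_property A -> (super_dense A <-> comeager A),
      exists A : set R,
        [/\ dense A, dense (~` A), ~ super_dense A & ~ super_dense (~` A)]
    & exists A : set R, super_dense A /\ super_dense (~` A)].
Proof.
split; last exact: super_dense_partition; last exact: dense_not_super_dense.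
move=> A Abp; split; first exact: super_dense_comeager.
exact: comeager_super_dense.
Qed.
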